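(* Let $A$ be a Banach algebra and suppose that $A^*$ has the $Rw^*wc$-property and $A^{**}$ has the $Lw^*wc$-property (both with respect to $A$). If $A^{**}$ is weakly amenable, then $A$ is weakly amenable.
   Context: For $a,b\in A$, $a'\in A^*$: $\langle a'a,b\rangle=\langle a',ab\rangle$ and $\langle aa',b\rangle=\langle a',ba\rangle$. For $a''\in A^{**}$: $\langle a''a',a\rangle=\langle a'',a'a\rangle$, so $a''a'\in A^*$. $A^{**}$ is a Banach algebra under the first Arens product $\langle a''b'',a'\rangle=\langle a'',b''a'\rangle$. $A$ is identified with its canonical image in $A^{**}$. $A^*$ has the $Rw^*wc$-property (right-weak$^*$-weak convergence property) with respect to $A$ if for every $a'\in A^*$, every $a''\in A^{**}$ and every net $(a_\alpha)\subseteq A$ with $a_\alpha\to a''$ weak$^*$ in $A^{**}$, one has $a_\alpha a'\to a''a'$ weakly in $A^*$. $A^{**}$ has the $Lw^*wc$-property (left-weak$^*$-weak convergence property) with respect to $A$ if for every $x''\in A^{**}$, every $a''\in A^{**}$ and every net $(a_\alpha)\subseteq A$ with $a_\alpha\to a''$ weak$^*$ in $A^{**}$, one has $x''a_\alpha\to x''a''$ weakly in $A^{**}$. A Banach algebra $C$ is weakly amenable if every bounded derivation $D:C\to C^*$ (i.e. bounded linear $D$ with $D(xy)=xD(y)+D(x)y$, with $C^*$ the dual $C$-bimodule) is inner, i.e. of the form $D(c)=cf-fc$ for some $f\in C^*$. *)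

(* Defs.v *)
From HB Require Import structures.
From mathcomp Require Import all_boot all_order all_algebra.
From mathcomp Require Import complex ring lra.
From mathcomp Require Import boolp classical_sets functions filter reals topology normedtype.
Set Implicit Arguments.
Unset Strict Implicit.
Unset Printing Implicit Defensive.
Import Order.TTheory GRing.Theory Num.Theory.
Import numFieldNormedType.Exports.
Local Open Scope classical_set_scope.
Local Open Scope ring_scope.

Variant scalar_kind := real_scalars | complex_scalars.

(* The ground field of a Banach algebra: the field of real numbers, or that of
   complex numbers. *)
Definition scalars (R : realType) (k : scalar_kind) : numFieldType :=
  match k with
  | real_scalars => R
  | complex_scalars => R[i]
  end.

(* The order of the complex numbers is the partial one, in which 0 <= x means
   that x is a nonnegative real; norms take their values in the ground field. *)
Lemma scalars_supremums (R : realType) k (E : set (scalars R k)) :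
  E !=set0 -> (forall x, E x -> 0 <= x) -> ubound E !=set0 ->
  supremums E !=set0.
Proof.
case: k E => /= E [e Ee] E0 [u uE].
  have hE : has_sup E by split; [exists e|exists u].
  exists (sup E); split; first exact: sup_upper_bound.
  by move=> y yE; apply: ge_sup => //; exists e.
have hE : has_sup (@complex.Re R @` E).
  split; first by exists (complex.Re e), e.
  exists (complex.Re u) => _ [x Ex <-].
  by have := uE x Ex; rewrite lecE => /andP[].
have im0 x : E x -> complex.Im x = 0 by move=> /E0 /ger0_Im.
exists (Complex (sup (@complex.Re R @` E)) 0); split.
  move=> x Ex; rewrite lecE /= im0// eqxx/=.
  by apply: (sup_upper_bound hE); exists x.
move=> y yE; rewrite lecE /=.
have := yE e Ee; rewrite lecE (im0 e)// => /andP[-> _] /=.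
apply: ge_sup; first by case: hE.
by move=> _ [x Ex <-]; have := yE x Ex; rewrite lecE => /andP[].
Qed.


Lemma complex_norm_Im (R : realType) (x : R[i]) :
  `|complex.Im x|%:C%C <= `|x|.
Proof.
have -> : complex.Im x = complex.Re (x * - 'i%C) by case: x => a b /=; ring.
apply: le_trans (normc_ge_Re _) _.
rewrite normrM normrN (_ : `|'i%C| = 1) ?mulr1//.
by rewrite normc_def /= expr0n expr1n add0r sqrtr1.
Qed.

Lemma cvg_numField (K : numFieldType) (F : set_system K) (l : K) :
  Filter F -> (forall e, 0 < e -> \forall z \near F, `|l - z| < e) -> cvg F.
Proof.
by move=> FF Fl; apply: (cvgP l); apply/cvgrPdist_lt => e e0; exact: Fl.
Qed.

Lemma scalars_complete (R : realType) k (F : set_system (scalars R k)) :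
  ProperFilter F -> cauchy F -> cvg F.
Proof.
case: k F => /= F FF; first exact: (@R_complete R).
move=> /cauchyP Fc.
have aux (g : R[i] -> R) : (forall x y, g (x - y) = g x - g y) ->
    (forall x, `|g x|%:C%C <= `|x|) -> cvg (g x @[x --> F]).
  move=> gB g_le; apply: R_complete; apply/cauchyP => e e0.
  have e0' : 0 < e%:C%C :> R[i] by rewrite ltcR.
  have [x xF] := Fc _ e0'.
  exists (g x); apply: (@filterS _ F _ _ _ _ xF) => y.
  change (`|x - y| < e%:C%C -> `|g x - g y| < e) => xy.
  by rewrite -gB -ltcR; exact: le_lt_trans (g_le _) xy.
have /cvg_ex[a Fa] : cvg (complex.Re x @[x --> F]).
  apply: aux => [[? ?] [? ?] //|x]; exact: normc_ge_Re.
have /cvg_ex[b Fb] : cvg (complex.Im x @[x --> F]).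
  apply: aux => [[? ?] [? ?] //|x]; exact: complex_norm_Im.
apply: (@cvg_numField _ F (Complex a b)) => e e0.
have [r r0 er] : exists2 r : R, 0 < r & e = r%:C%C.
  exists (complex.Re e); first by move: e0; rewrite ltcE => /andP[].
  by rewrite RRe_real// gtr0_real.
have r20 : 0 < r / 2 by rewrite divr_gt0.
have Fa' := @cvgr_dist_lt _ _ _ _ _ _ _ Fa _ r20.
have Fb' := @cvgr_dist_lt _ _ _ _ _ _ _ Fb _ r20.
apply: filterS2 (Fa' _) (Fb' _) => z az bz.
have -> : Complex a b - z =
    (a - complex.Re z)%:C%C + 'i%C * (b - complex.Im z)%:C%C.
  by rewrite [LHS]complexE; clear; case: z.
rewrite (le_lt_trans (ler_normD _ _))// normrM.
have ni : `|'i%C| = 1 :> R[i] by rewrite normc_def /= expr0n expr1n add0r sqrtr1.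
rewrite ni mul1r !normc_def /= expr0n/= !addr0 !sqrtr_sqr er -rmorphD/= ltcR.
by rewrite [ltRHS]splitr ltrD.
Qed.

Section Dual.
Variables (R : realType) (k : scalar_kind).
Local Notation K := (scalars R k).
Variable V : normedModType K.

Definition continuous_linear_form : {pred V -> K^o} :=
  fun f => `[< linear f /\ continuous f >].

Fact continuous_linear_formP f :
  reflect (linear f /\ continuous f) (f \in continuous_linear_form).
Proof. exact: asboolP. Qed.

Record dual := Dual {
  dual_fun :> V -> K^o;
  dual_funP : dual_fun \in continuous_linear_form }.

Fact continuous_linear_form_submod : submod_closed continuous_linear_form.
Proof.
split=> [|a f g]; last (move=> /continuous_linear_formP[lf cf]
  /continuous_linear_formP[lg cg]); apply/continuous_linear_formP; split.
- by move=> a x y; rewrite /= scaler0 addr0.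
- by move=> x; exact: cvg_cst.
- move=> b x y; rewrite !fctE lf lg !scalerDr !scalerA mulrC.
  by rewrite addrACA.
- by move=> x; apply: cvgD (cg x); apply: cvgZr (cf x).
Qed.

HB.instance Definition _ := [isSub for dual_fun].
HB.instance Definition _ := [Choice of dual by <:].
HB.instance Definition _ := GRing.isSubmodClosed.Build K (V -> K^o)
  continuous_linear_form continuous_linear_form_submod.
HB.instance Definition _ := [SubChoice_isSubLmodule of dual by <:].

Lemma dual_linear (f : dual) : linear f.
Proof. by case: f => f /= /continuous_linear_formP[]. Qed.

Lemma dual_continuous (f : dual) : continuous f.
Proof. by case: f => f /= /continuous_linear_formP[]. Qed.

HB.instance Definition _ (f : dual) :=
  GRing.isLinear.Build K V K^o *:%R (dual_fun f) (dual_linear f).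

Lemma dual_linearZ (f : dual) a x : f (a *: x) = a *: f x.
Proof. exact: linearZ. Qed.

Lemma dual_ext (f g : dual) : (forall x, f x = g x) -> f = g.
Proof. by move=> fg; apply/val_inj/funext. Qed.

Lemma dualDE (f g : dual) x : (f + g) x = f x + g x. Proof. by []. Qed.
Lemma dualBE (f g : dual) x : (f - g) x = f x - g x. Proof. by []. Qed.
Lemma dualZE a (f : dual) x : (a *: f) x = a * f x. Proof. by []. Qed.
Lemma dual0E x : (0 : dual) x = 0. Proof. by []. Qed.

Lemma bounded_linear_form (f : V -> K^o) (M : K) : linear f ->
  (forall x, `|f x| <= M * `|x|) -> f \in continuous_linear_form.
Proof.
move=> lf fM; apply/continuous_linear_formP; split => //.
pose L : {linear V -> K^o} := HB.pack f (GRing.isLinear.Build _ _ _ _ _ lf).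
suff : continuous L by [].
apply/linear_bounded_continuous/linear_boundedP.
exists `|M|; split; first exact: normr_real.
move=> r Mr x; have [->|x0] := eqVneq x 0.
  by rewrite linear0 !normr0 mulr0.
apply: le_trans (fM x) _; apply: ler_wpM2r => //.
suff M0 : 0 <= M by rewrite -(ger0_norm M0) ltW.
by rewrite -(pmulr_lge0 _ (_ : 0 < `|x|)) ?normr_gt0// (le_trans _ (fM x)).
Qed.

Lemma dual_bounded (f : dual) : exists M, forall x, `|f x| <= M * `|x|.
Proof.
have /linear_bounded_continuous/linear_boundedP fM := @dual_continuous f.
by have [M _ fM'] := pinfty_ex_gt0 fM; exists M.
Qed.

(* The operator norm, sup {|f x| : |x| <= 1}. *)
Definition dual_norm (f : dual) : K :=
  supremum 0 [set `|f x| | x in [set x | `|x| <= 1]].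

Lemma dual_norm_supremums (f : dual) :
  supremums [set `|f x| | x in [set x | `|x| <= 1]]
    (dual_norm f).
Proof.
rewrite /dual_norm /supremum; case: ifPn => [/eqP f0|_].
  suff : [set `|f x| | x in [set x | `|x| <= 1]] `|f 0| by rewrite f0.
  by exists 0; rewrite //= normr0.
apply: xgetPex; apply: scalars_supremums.
- by exists `|f 0|; exists 0; rewrite //= normr0.
- by move=> _ [x _ <-].
have [M fM] := dual_bounded f.
exists `|M| => _ [x /= x1 <-].
have [->|x0] := eqVneq x 0; first by rewrite linear0 normr0.
have M0 : 0 <= M.
  by rewrite -(pmulr_lge0 _ (_ : 0 < `|x|)) ?normr_gt0// (le_trans _ (fM x)).
by apply: le_trans (fM x) _; rewrite (ger0_norm M0) ler_piMr.
Qed.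

Lemma dual_norm_ge0 (f : dual) : 0 <= dual_norm f.
Proof.
have [ub _] := dual_norm_supremums f; apply: le_trans (ub `|f 0| _) => //.
by exists 0; rewrite //= normr0.
Qed.

Lemma dual_norm_bound (f : dual) x : `|f x| <= dual_norm f * `|x|.
Proof.
have [->|x0] := eqVneq x 0; first by rewrite linear0 !normr0 mulr0.
have [ub _] := dual_norm_supremums f.
rewrite -ler_pdivrMr ?normr_gt0//.
apply: ub; exists (`|x|^-1 *: x).
  by rewrite /= normrZ normfV normr_id mulVf ?normr_eq0.
by rewrite linearZ normrZ normfV normr_id mulrC.
Qed.

Lemma dual_norm_le (f : dual) M : 0 <= M ->
  (forall x, `|f x| <= M * `|x|) -> dual_norm f <= M.
Proof.
move=> M0 fM; have [_ lub] := dual_norm_supremums f; apply: lub.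
by move=> _ [x /= x1 <-]; apply: le_trans (fM x) _; rewrite ler_piMr.
Qed.

Fact dual_ler_normD f g : dual_norm (f + g) <= dual_norm f + dual_norm g.
Proof.
apply: dual_norm_le => [|x]; first by rewrite addr_ge0 ?dual_norm_ge0.
rewrite dualDE mulrDl (le_trans (ler_normD _ _))//.
by rewrite lerD ?dual_norm_bound.
Qed.

Fact dual_normrZ a f : dual_norm (a *: f) = `|a| * dual_norm f.
Proof.
have le b g : dual_norm (b *: g) <= `|b| * dual_norm g.
  apply: dual_norm_le => [|x]; first by rewrite mulr_ge0 ?dual_norm_ge0.
  by rewrite dualZE normrM -mulrA ler_wpM2l ?dual_norm_bound.
have [->|a0] := eqVneq a 0.
  rewrite scale0r normr0 mul0r; apply/eqP; rewrite eq_le dual_norm_ge0 andbT.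
  by apply: dual_norm_le => // x; rewrite dual0E normr0 mul0r.
apply/eqP; rewrite eq_le le/= -ler_pdivlMl ?normr_gt0//.
by rewrite -normfV (le_trans _ (le _ _))// scalerA mulVf// scale1r.
Qed.

Fact dual_norm_eq0 f : dual_norm f = 0 -> f = 0.
Proof.
move=> f0; apply: dual_ext => x; apply/eqP; rewrite -normr_eq0 eq_le.
by rewrite normr_ge0 andbT (le_trans (dual_norm_bound f x))// f0 mul0r.
Qed.

HB.instance Definition _ := Lmodule_isNormed.Build K dual
  dual_ler_normD dual_normrZ dual_norm_eq0.

Lemma dual_le_norm (f : dual) x : `|f x| <= `|f| * `|x|.
Proof. exact: dual_norm_bound. Qed.

Lemma dual_norm_leP (f : dual) M : 0 <= M ->
  (forall x, `|f x| <= M * `|x|) -> `|f| <= M.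
Proof. exact: dual_norm_le. Qed.

Fact dual_complete (F : set_system dual) :
  ProperFilter F -> cauchy F -> cvg F.
Proof.
move=> FF /cauchyP Fc.
have Fx x : cvg ((fun f : dual => f x) @ F).
  apply: scalars_complete; apply/cauchyP => e e0.
  have e0' : 0 < e / (`|x| + 1) by rewrite divr_gt0// ltr_wpDl.
  have [f Ff] := Fc _ e0'; exists (f x).
  apply: (@filterS _ F _ _ _ _ Ff) => g; rewrite -ball_normE /= => fg.
  suff : `|f x - g x| < e by [].
  rewrite -dualBE (le_lt_trans (dual_le_norm _ _))//.
  move: fg; rewrite ltr_pdivlMr ?ltr_wpDl// => /(le_lt_trans _); apply.
  by rewrite ler_wpM2l// lerDl.
pose g x := lim ((fun f : dual => f x) @ F).
have gE x : (fun f : dual => f x) @ F --> g x by exact: Fx.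
have lg : linear g.
  move=> a x y; apply: (cvg_unique _ (gE (a *: x + y))); first exact: norm_hausdorff.
  have h : (fun f : dual => a *: f x + f y) @ F --> a *: g x + g y.
    by apply: cvgD (gE y); exact: cvgZr (gE x).
  apply: cvg_trans h; apply: near_eq_cvg; apply: nearW => f.
  by rewrite (dual_linear f).
have g_near f e : F (ball f e) -> forall x, `|f x - g x| <= e * `|x|.
  move=> Ff x; have e0 : 0 < e.
    have [h] := filter_ex Ff; rewrite -ball_normE /=; exact: le_lt_trans.
  rewrite real_leNgt ?ger0_real// ?(mulr_ge0 (ltW e0))//; apply/negP => ltfg.
  have d0 : 0 < `|f x - g x| - e * `|x| by rewrite subr_gt0.
  have gx1 := @cvgr_dist_lt _ _ _ _ _ _ _ (gE x) _ d0.
  have [h [hf hg]] := filter_ex (filterI Ff (gx1 _)).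
  move: hf; rewrite -ball_normE /= => hf.
  suff : `|f x - g x| < `|f x - g x| by rewrite ltxx.
  rewrite -[X in `|X| < _](subrKA (h x)) (le_lt_trans (ler_normD _ _))//.
  rewrite -ltrBrDl distrC (lt_le_trans hg)// lerD2l lerN2.
  by rewrite -dualBE (le_trans (dual_le_norm _ _))// ler_wpM2r// ltW.
have [f1 Ff1] := Fc 1 ltr01.
have gM : forall x, `|g x| <= (`|f1| + 1) * `|x|.
  move=> x; rewrite -[g x](subKr (f1 x)) (le_trans (ler_normB _ _))// mulrDl.
  by rewrite lerD ?dual_le_norm// g_near.
pose g' := Dual (bounded_linear_form lg gM).
apply: (cvgP g'); apply/cvgrPdist_lt => e e0.
have e20 : 0 < e / 2 / 2 by rewrite !divr_gt0.
have [f Ff] := Fc _ e20.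
have g'f : `|f - g'| <= e / 2 / 2.
  by apply: dual_norm_leP => [|x]; [exact: ltW|rewrite dualBE g_near].
apply: (@filterS _ F _ _ _ _ Ff) => h; rewrite -ball_normE /= => fh.
rewrite -(subrKA f) (le_lt_trans (ler_normD _ _))// distrC.
rewrite (@le_lt_trans _ _ (e / 2))//; last by rewrite ltr_pdivrMr// ltr_pMr// ltr1n.
by rewrite [leRHS]splitr lerD// ltW.
Qed.

HB.instance Definition _ := Uniform_isComplete.Build dual dual_complete.

End Dual.

Arguments continuous_linear_form {R k} V f.

HB.mixin Record CompleteNormedModule_isBanachAlgebra (K : numFieldType) A
    of CompleteNormedModule K A := {
  bmul : A -> A -> A;
  bmulA : associative bmul;
  bmulDl : left_distributive bmul +%R;
  bmulDr : right_distributive bmul +%R;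
  bscaleAl : forall (c : K) x y, bmul (c *: x) y = c *: bmul x y;
  bscaleAr : forall (c : K) x y, bmul x (c *: y) = c *: bmul x y;
  norm_bmul : forall x y, `|bmul x y| <= `|x| * `|y|
}.

(* Not assumed unital. *)
#[short(type="banachAlgType")]
HB.structure Definition BanachAlgebra (K : numFieldType) :=
  {A of CompleteNormedModule K A & CompleteNormedModule_isBanachAlgebra K A}.

Notation "x *b y" := (bmul x y) (at level 40, left associativity).

Section Arens.
Variables (R : realType) (k : scalar_kind).
Local Notation K := (scalars R k).
Variable A : banachAlgType K.
Implicit Types (a b : A) (f : dual A) (u v : dual (dual A)).

Fact ract_subproof f a : (fun b => f (a *b b)) \in continuous_linear_form A.
Proof.
apply: (@bounded_linear_form _ _ _ _ (`|f| * `|a|)) => [c x y|x].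
  by rewrite bmulDr bscaleAr dual_linear.
by rewrite /= (le_trans (dual_le_norm _ _))// -mulrA ler_wpM2l// ?norm_bmul.
Qed.

Fact lact_subproof a f : (fun b => f (b *b a)) \in continuous_linear_form A.
Proof.
apply: (@bounded_linear_form _ _ _ _ (`|f| * `|a|)) => [c x y|x].
  by rewrite bmulDl bscaleAl dual_linear.
by rewrite (le_trans (dual_le_norm _ _))// -mulrA ler_wpM2l// mulrC norm_bmul.
Qed.

(* The dual A-bimodule: <fa, b> = <f, ab> and <af, b> = <f, ba>. *)
Definition ract f a : dual A := Dual (ract_subproof f a).
Definition lact a f : dual A := Dual (lact_subproof a f).

Lemma ract_norm f a : `|ract f a| <= `|f| * `|a|.
Proof.
apply: dual_norm_leP => [|x]; first exact: mulr_ge0.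
by rewrite /= (le_trans (dual_le_norm _ _))// -mulrA ler_wpM2l// ?norm_bmul.
Qed.

Fact bidual_act_subproof u f :
  (fun a => u (ract f a)) \in continuous_linear_form A.
Proof.
apply: (@bounded_linear_form _ _ _ _ (`|u| * `|f|)) => [c x y|x].
  rewrite -dual_linear; congr (u _); apply: dual_ext => b /=.
  by rewrite bmulDl bscaleAl dual_linear.
by rewrite /= (le_trans (dual_le_norm _ _))// -mulrA ler_wpM2l// ?ract_norm.
Qed.

(* <uf, a> = <u, fa> *)
Definition bidual_act u f : dual A := Dual (bidual_act_subproof u f).

Lemma bidual_act_norm u f : `|bidual_act u f| <= `|u| * `|f|.
Proof.
apply: dual_norm_leP => [|x]; first exact: mulr_ge0.
by rewrite /= (le_trans (dual_le_norm _ _))// -mulrA ler_wpM2l// ?ract_norm.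
Qed.

Fact arens_subproof u v :
  (fun f => u (bidual_act v f)) \in continuous_linear_form (dual A).
Proof.
apply: (@bounded_linear_form _ _ _ _ (`|u| * `|v|)) => [c f g|f].
  rewrite -dual_linear; congr (u _); apply: dual_ext => a /=.
  apply: etrans (dual_linear v c (ract f a) (ract g a)).
  by congr (v _); apply: dual_ext.
by rewrite /= (le_trans (dual_le_norm _ _))// -mulrA ler_wpM2l// ?bidual_act_norm.
Qed.

(* The first Arens product: <uv, f> = <u, vf>. *)
Definition arens u v : dual (dual A) := Dual (arens_subproof u v).

Fact arensA : associative arens.
Proof.
move=> u v w; apply: dual_ext => f /=; congr (u _); apply: dual_ext => a /=.
congr (v _); apply: dual_ext => b /=; congr (w _); apply: dual_ext => c /=.
by rewrite bmulA.
Qed.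

Fact arensDl : left_distributive arens +%R.
Proof. by move=> u v w; apply: dual_ext. Qed.

Fact arensDr : right_distributive arens +%R.
Proof.
move=> u v w; apply: dual_ext => f.
apply: etrans (linearD u (bidual_act v f) (bidual_act w f)).
by apply: (congr1 (dual_fun u)); apply: dual_ext.
Qed.

Fact arensZl (c : K) u v : arens (c *: u) v = c *: arens u v.
Proof. exact: dual_ext. Qed.

Fact arensZr (c : K) u v : arens u (c *: v) = c *: arens u v.
Proof.
apply: dual_ext => f.
apply: etrans (dual_linearZ u c (bidual_act v f)).
by apply: (congr1 (dual_fun u)); apply: dual_ext.
Qed.

Fact arens_norm u v : `|arens u v| <= `|u| * `|v|.
Proof.
apply: dual_norm_leP => [|f]; first exact: mulr_ge0.
by rewrite /= (le_trans (dual_le_norm _ _))// -mulrA ler_wpM2l// ?bidual_act_norm.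
Qed.

HB.instance Definition _ :=
  CompleteNormedModule_isBanachAlgebra.Build K (dual (dual A))
    arensA arensDl arensDr arensZl arensZr arens_norm.

End Arens.

Section Canonical.
Variables (R : realType) (k : scalar_kind).
Local Notation K := (scalars R k).
Variable V : normedModType K.

Fact to_bidual_subproof (x : V) :
  (fun f : dual V => f x) \in continuous_linear_form (dual V).
Proof.
apply: (@bounded_linear_form _ _ _ _ `|x|) => // f.
by rewrite mulrC dual_le_norm.
Qed.

Definition to_bidual (x : V) : dual (dual V) := Dual (to_bidual_subproof x).

(* Convergence along F for the weak topology of V. *)
Definition weak_cvg (I : Type) (F : set_system I) (x_ : I -> V) (x : V) :=
  forall phi : dual V, (fun i => phi (x_ i)) @ F --> phi x.

(* Convergence along F for the weak* topology of the dual of V. *)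
Definition weakstar_cvg (I : Type) (F : set_system I) (f_ : I -> dual V)
    (f : dual V) :=
  forall x : V, (fun i => f_ i x) @ F --> f x.

End Canonical.

(* A net is a family indexed by a directed set; it converges when it does along
   the filter generated by the tails of that set. *)
Definition directed (I : Type) (le : I -> I -> Prop) :=
  [/\ inhabited I, forall i, le i i,
      forall i j l, le i j -> le j l -> le i l &
      forall i j, exists l, le i l /\ le j l].

Definition tails (I : Type) (le : I -> I -> Prop) : set_system I :=
  filter_from [set: I] (fun i => [set j | le i j]).

(* On A, identified with its image in A^**, the two left actions on A^* agree,
   and the Arens product extends that of A. *)
Lemma bidual_act_to_bidual (R : realType) k (A : banachAlgType (scalars R k))
  (a : A) (f : dual A) : bidual_act (to_bidual a) f = lact a f.
Proof. exact: dual_ext. Qed.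

Lemma to_bidual_bmul (R : realType) k (A : banachAlgType (scalars R k)) (a b : A) :
  to_bidual (a *b b) = to_bidual a *b to_bidual b.
Proof. exact: dual_ext. Qed.

Section WeakAmenability.
Variables (R : realType) (k : scalar_kind).
Local Notation K := (scalars R k).

(* A^* has the Rw*wc-property with respect to A. *)
Definition dual_Rwstarwc (A : banachAlgType K) :=
  forall (f : dual A) (u : dual (dual A))
    (I : Type) (le : I -> I -> Prop) (a : I -> A), directed le ->
  weakstar_cvg (tails le) (fun i => to_bidual (a i)) u ->
  weak_cvg (tails le) (fun i => lact (a i) f) (bidual_act u f).

(* A^** has the Lw*wc-property with respect to A. *)
Definition bidual_Lwstarwc (A : banachAlgType K) :=
  forall (v u : dual (dual A))
    (I : Type) (le : I -> I -> Prop) (a : I -> A), directed le ->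
  weakstar_cvg (tails le) (fun i => to_bidual (a i)) u ->
  weak_cvg (tails le) (fun i => v *b to_bidual (a i)) (v *b u).

Definition bounded_derivation (C : banachAlgType K)
    (D : {linear C -> dual C}) :=
  (exists M : K, forall x, `|D x| <= M * `|x|) /\
  (forall x y, D (x *b y) = lact x (D y) + ract (D x) y).

Definition inner_derivation (C : banachAlgType K) (D : C -> dual C) :=
  exists f : dual C, forall c, D c = lact c f - ract f c.

Definition weakly_amenable (C : banachAlgType K) :=
  forall D : {linear C -> dual C}, bounded_derivation D -> inner_derivation D.

End WeakAmenability.

(* Main.v *)
(** Let [D : A -> A*] be a bounded derivation and [D'' : A** -> A***] its second
    adjoint.  Computing [<D''(uv), w>] from the derivation rule for [D] gives
    [<D''u, vw>] plus the value of [u] at the functional [a |-> <D''v, wa>].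
    For a net [a_i] of [A] converging weak* to [u], the values of this functional
    at [a_i] tend to its value under [u], and also to [<D''v, wu>] by the
    Lw*wc-property.  Hence [D''] is a derivation, and so is inner, implemented
    by some [F] in [A***]; the restriction of [F] to [A] implements [D]. *)
Require Import Defs.
From HB Require Import structures.
From mathcomp Require Import all_boot all_order all_algebra.
From mathcomp Require Import boolp classical_sets functions filter.
From mathcomp Require Import reals topology normedtype.
Set Implicit Arguments.
Unset Strict Implicit.
Unset Printing Implicit Defensive.
Import Order.TTheory GRing.Theory Num.Theory.
Import numFieldNormedType.Exports.
Local Open Scope classical_set_scope.
Local Open Scope ring_scope.

Section ToBidual.
Variables (R : realType) (k : scalar_kind) (V : normedModType (scalars R k)).

Fact to_bidual_linear : linear (@to_bidual R k V).
Proof. by move=> c x y; apply: dual_ext => f; exact: dual_linear. Qed.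

HB.instance Definition _ := GRing.isLinear.Build (scalars R k) V
  (dual (dual V)) *:%R (@to_bidual R k V) to_bidual_linear.

Lemma to_bidual_norm (x : V) : `|to_bidual x| <= 1 * `|x|.
Proof.
rewrite mul1r; apply: dual_norm_leP => // f.
by rewrite mulrC /= dual_le_norm.
Qed.

End ToBidual.

Section WeakStarDensity.
Variables (R : realType) (k : scalar_kind).
Local Notation K := (scalars R k).
Variable V : normedModType K.
Implicit Types (f g : dual V) (u : dual (dual V)) (s : seq (dual V)).

(* The kernel hypothesis amounts to [f] lying in the span of [s]. *)
Lemma bidual_eq0_of_kernels s f u :
  (forall x, (forall g, g \in s -> g x = 0) -> f x = 0) ->
  (forall g, g \in s -> u g = 0) -> u f = 0.
Proof.
elim: s f => [|g s IHs] f fker us.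
  suff -> : f = 0 by rewrite linear0.
  by apply: dual_ext => x; exact: fker.
have us' h : h \in s -> u h = 0.
  by move=> hs; apply: us; rewrite inE hs orbT.
have [gker|/existsNP[b /not_implyP[bs gb]]] :=
    pselect (forall x, (forall h, h \in s -> h x = 0) -> g x = 0).
  apply: IHs => // x xs; apply: fker => h.
  by rewrite inE => /predU1P[->|/xs //]; exact: gker.
have /eqP gb0 := gb.
(* Subtracting this multiple of [g] removes [g] from the list: any [x] killed by [s] becomes killed
   by [g] as well once [(g x / g b) *: b] is taken off it. *)
have : u (f - (f b / g b) *: g) = 0.
  apply: IHs => // x xs.
  have : f (x - (g x / g b) *: b) = 0.
    apply: fker => h; rewrite inE linearB linearZ /= => /predU1P[->|hs].
      by rewrite /GRing.scale /= divfK// subrr.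
    by rewrite (xs h hs) (bs h hs) /GRing.scale /= mulr0 subr0.
  rewrite linearB linearZ /= /GRing.scale /= => /subr0_eq fx.
  by apply/eqP; rewrite subr_eq0 fx mulrAC [g x * _]mulrC mulrAC.
rewrite linearB linearZ /= (us g (mem_head _ _)) /GRing.scale /= mulr0.
by rewrite subr0.
Qed.

(** By induction on [s]. If [f] vanishes on the common kernel of [s], its value is already forced;
    otherwise some [b] in that kernel with [f b] nonzero corrects the value at [f] without
    disturbing [s]. *)
Lemma bidual_interpolation u s : exists a : V, forall f, f \in s -> f a = u f.
Proof.
elim: s => [|f s [a as_]]; first by exists 0.
have [fker|/existsNP[b /not_implyP[bs fb]]] :=
    pselect (forall x, (forall h, h \in s -> h x = 0) -> f x = 0).
  exists a => h; rewrite inE => /predU1P[->|/as_ //].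
  have : (u - to_bidual a) f = 0.
    apply: bidual_eq0_of_kernels fker _ => g gs.
    by rewrite dualBE /= as_// subrr.
  by rewrite dualBE /= => /subr0_eq.
have /eqP fb0 := fb.
exists (a + ((u f - f a) / f b) *: b) => h.
rewrite inE linearD linearZ /= => /predU1P[->|hs].
  by rewrite /GRing.scale /= divfK// addrC subrK.
by rewrite (bs h hs) /GRing.scale /= mulr0 addr0 as_.
Qed.

(** The net is indexed by finite lists of functionals under inclusion, each sent to a point
    interpolating [u] on it, so at any given functional its values are eventually constant. No norm
    bound on the net is claimed. *)
Lemma weakstar_dense u : exists (I : Type) (le : I -> I -> Prop) (a : I -> V),
  directed le /\ weakstar_cvg (tails le) (fun i => to_bidual (a i)) u.
Proof.
have [a aE] := choice (bidual_interpolation u).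
exists (seq (dual V)), (fun s t => {subset s <= t}), a; split.
  split; [by constructor; exact: [::]|by move=> s x| |].
    by move=> s t r st tr x /st /tr.
  by move=> s t; exists (s ++ t); split=> x xs; rewrite mem_cat xs ?orbT.
move=> f U /nbhs_singleton Uf; exists [:: f] => // s fs /=.
by rewrite aE//; apply: fs; rewrite mem_head.
Qed.

End WeakStarDensity.

Lemma directed_tails_filter (I : Type) (le : I -> I -> Prop) :
  directed le -> ProperFilter (tails le).
Proof.
move=> [[i0] lexx le_trans leU]; apply: filter_from_proper.
  apply: filter_from_filter; first by exists i0.
  move=> i j _ _; have [l [il jl]] := leU i j.
  by exists l => // m lm; split; apply: le_trans lm.
by move=> i _; exists i; exact: lexx.
Qed.

Section Adjoint.
Variables (R : realType) (k : scalar_kind).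
Local Notation K := (scalars R k).
Variables (V W : normedModType K) (T : {linear V -> W}) (M : K).
Hypothesis T_le : forall x, `|T x| <= M * `|x|.

Fact adjoint_subproof (f : dual W) :
  (fun x => f (T x)) \in continuous_linear_form V.
Proof.
apply: (@bounded_linear_form _ _ _ _ (`|f| * M)) => [c x y|x].
  by rewrite linearP dual_linear.
by rewrite (le_trans (dual_le_norm _ _))// -mulrA ler_wpM2l.
Qed.

Definition adjoint f : dual V := Dual (adjoint_subproof f).

Fact adjoint_linear : linear adjoint.
Proof. by move=> c f g; exact: dual_ext. Qed.

HB.instance Definition _ :=
  GRing.isLinear.Build K (dual W) (dual V) *:%R adjoint adjoint_linear.

(** The absolute value of [M] is taken because [T_le] does not force [M] to be nonnegative when [V]
    is zero. *)
Lemma adjoint_norm f : `|adjoint f| <= `|M| * `|f|.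
Proof.
apply: dual_norm_leP => [|x]; first exact: mulr_ge0.
rewrite /= (le_trans (dual_le_norm _ _))// [`|M| * _]mulrC -mulrA ler_wpM2l//.
rewrite -[`|x|]normr_id -normrM ger0_norm//.
exact: le_trans (T_le x).
Qed.

End Adjoint.

Section SecondAdjoint.
Variables (R : realType) (k : scalar_kind).
Local Notation K := (scalars R k).
Variables (A : banachAlgType K) (D : {linear A -> dual A}) (M : K).
Hypothesis D_le : forall x, `|D x| <= M * `|x|.
Hypothesis D_mul : forall x y, D (x *b y) = lact x (D y) + ract (D x) y.
Implicit Types u v w : dual (dual A).

Let D' : {linear dual (dual A) -> dual A} := adjoint D_le.
Let D'' : {linear dual (dual A) -> dual (dual (dual A))} :=
  adjoint (adjoint_norm D_le).

(** Obtained by applying [v] and [w] to [D_mul]. It exhibits the functional sending [a] to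
    [D'' v (w *b to_bidual a)] as an element of [dual A], at which weak* convergence can be
    tested. *)
Lemma bidual_act_adjoint v w (a : A) :
  bidual_act v (D' w) a = D'' v (w *b to_bidual a) + D' (v *b w) a.
Proof.
rewrite /= -linearD; congr (v _); apply: dual_ext => b /=.
rewrite D_mul linearD /=; congr (w _ + _); exact: dual_ext.
Qed.

Lemma second_adjoint_derivation : bidual_Lwstarwc A ->
  forall u v, D'' (u *b v) = lact u (D'' v) + ract (D'' u) v.
Proof.
move=> LA u v; apply: dual_ext => w; rewrite dualDE.
set g : dual A := bidual_act v (D' w) - D' (v *b w).
suff : u g = D'' v (w *b u).
  by rewrite /g linearB => /eqP; rewrite subr_eq => /eqP.
have [I [le [a [dir_le au]]]] := weakstar_dense u.
have tailsP := directed_tails_filter dir_le.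
have gcvg : (fun i => to_bidual (a i) g) @ tails le --> D'' v (w *b u).
  have gE x : g x = D'' v (w *b to_bidual x).
    by rewrite /g dualBE bidual_act_adjoint addrK.
  rewrite (_ : (fun i => _) = fun i => D'' v (w *b to_bidual (a i))).
    (* [D'' v] is itself a functional on the bidual, so weak convergence may be tested at it. *)
    exact: LA.
  by apply: funext => i; exact: gE.
exact: (cvg_unique (@norm_hausdorff _ _) (au g) gcvg).
Qed.

End SecondAdjoint.

Theorem mainTheorem4 (R : realType) (k : scalar_kind)
    (A : banachAlgType (scalars R k)) :
  dual_Rwstarwc A -> bidual_Lwstarwc A ->
  weakly_amenable (dual (dual A)) -> weakly_amenable A.
Proof.
move=> _ LA WA D [[M D_le] D_mul].
have [|F FE] := WA (adjoint (adjoint_norm D_le)).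
  split; last exact: second_adjoint_derivation.
  by exists `| `|M| |; exact: adjoint_norm.
(* The adjoint of the canonical embedding restricts [F] to [A]. *)
exists (adjoint (@to_bidual_norm _ _ A) F) => a; apply: dual_ext => b.
have := congr1 (fun G => dual_fun G (to_bidual b)) (FE (to_bidual a)).
rewrite !dualBE /= -!to_bidual_bmul; exact.
Qed.
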